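(* Let $p$ be a prime and let $m, n \geq 1$ be integers. For $\sigma, \sigma' \in S_n$, the following are equivalent: (i) $\sigma \sim_m^{comb} \sigma'$; (ii) $\sigma \sim_m \sigma'$; (iii) $\chi(\sigma) \equiv \chi(\sigma') \mod p^m$ for all characters $\chi$ of $S_n$.
   Context: $S_n$ is the symmetric group on $n$ letters; its complex characters are integer-valued. The cycle type of $\sigma \in S_n$ is the partition of $n$ formed by the lengths of the cycles of $\sigma$ (fixed points included). The relation $\sim_m^{comb}$ on partitions of $n$ is the equivalence relation generated by $\lambda \sim_m^{comb} \mu$ whenever $\mu$ is formed from $\lambda$ by replacing $p^m$ parts of size $k$ with $p^{m-1}$ parts of size $kp$ (for some $k \geq 1$). For $\sigma, \sigma' \in S_n$, $\sigma \sim_m^{comb} \sigma'$ means that the cycle types of $\sigma$ and $\sigma'$ are equivalent under $\sim_m^{comb}$. For a group $G$ and $m \geq 1$, $\sim_m$ is the equivalence relation on $G$ generated by conjugation together with $g \sim_m g h^{p^{m-1}}$ whenever $g,h \in G$, $h$ commutes with $g$ and $h$ has order a power of $p$. In (ii) this is applied to $G = S_n$. *)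

(* Defs.v *)
From Stdlib Require Export Relation_Operators.
From HB Require Export structures.
From mathcomp Require Export all_boot all_order all_fingroup all_algebra.
From mathcomp Require Export all_solvable all_field all_character.

Set Implicit Arguments.
Unset Strict Implicit.
Unset Printing Implicit Defensive.

Definition is_intpart_of (n : nat) (l : seq nat) : bool :=
  [&& sorted geq l, 0 \notin l & sumn l == n].

Definition intpart (n : nat) : Type := {l : seq nat | is_intpart_of n l}.

Definition cycle_lengths (n : nat) (s : 'S_n) : seq nat :=
  sort geq [seq #|C| | C : {set 'I_n} <- enum (porbits s)].

Lemma cycle_lengths_intpart (n : nat) (s : 'S_n) :
  is_intpart_of n (cycle_lengths s).
Proof.
apply/and3P; split.
- by apply: sort_sorted => a b; apply: leq_total.
- rewrite mem_sort; apply/mapP => -[C]; rewrite mem_enum => /imsetP[x _ ->].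
  by move/eqP; rewrite eq_sym (negPf (card_porbit_neq0 s x)).
- rewrite (perm_sumn (permEl (perm_sort geq _))) sumnE big_map big_enum /=.
  rewrite -[X in _ == X]card_ord -cardsT; apply/eqP.
  rewrite -(acts_sum_card_orbit (to := perm_action 'I_n) (G := <[s]>%G)).
    apply: eq_bigl => C; rewrite /porbits.
    by apply/imsetP/imsetP => -[x _ ->]; exists x; rewrite ?inE ?porbitE.
  by apply/actsP => a _ x; rewrite !inE.
Qed.

Definition cycle_type (n : nat) (s : 'S_n) : intpart n :=
  exist _ (cycle_lengths s) (cycle_lengths_intpart s).

(* [nu] collects the parts that are left untouched; [perm_eq] compares the
   lists of parts as multisets. *)
Definition comb_step (p m n : nat) (la mu : intpart n) : Prop :=
  exists (k : nat) (nu : seq nat),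
    [/\ 0 < k,
        perm_eq (sval la) (nseq (p ^ m) k ++ nu)
      & perm_eq (sval mu) (nseq (p ^ m.-1) (k * p) ++ nu)].

Definition comb_equiv (p m n : nat) : intpart n -> intpart n -> Prop :=
  clos_refl_sym_trans (intpart n) (@comb_step p m n).

Inductive group_step (p m : nat) (gT : finGroupType) : gT -> gT -> Prop :=
| GroupStepConj (g x : gT) : group_step p m g (g ^ x)%g
| GroupStepMul (g h : gT) :
    commute g h -> (exists e : nat, #[h]%g = p ^ e) ->
    group_step p m g (g * h ^+ (p ^ m.-1))%g.

Definition group_equiv (p m : nat) (gT : finGroupType) : gT -> gT -> Prop :=
  clos_refl_sym_trans gT (@group_step p m gT).

(* Main.v *)
Require Import Defs.
From mathcomp Require Import zify ring.

Import GRing.Theory Num.Theory.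

(** Why the three relations agree.

    Two implications start from the combinatorial relation.  Trading [p ^ m]
    cycles of length [k] for [p ^ m.-1] cycles of length [k * p] takes place
    inside the powers of a single cycle [R] of length [N = k * p ^ m]: the
    power [R ^+ (p ^ m)] has the first shape and [R ^+ (p ^ m.-1)] the second,
    while a disjoint permutation [t] carries the parts that do not move
    ([comb_step_juxt]).

    - Some power [h] of [R] has order a power of [p] and makes
      [R ^+ (p ^ m.-1) * h ^+ (p ^ m.-1)] generate the same group as
      [R ^+ (p ^ m)]; this is a step of the group relation
      ([comb_step_group_equiv]).

    - For a character [chi], the value [F a] of [chi] at [R ^+ a] times [t]
      depends only on [gcdn N a], because the cycle type does.  Its Fourier
      coefficients are algebraic integers, and these two facts together force
      [F a] to be the sum of [e * c e] over the common divisors [e] of [N] and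
      [a], with [c e] algebraic integers ([gcd_fourier_coef]).  Only
      [e = p ^ m] distinguishes [a = p ^ m] from [a = p ^ m.-1], so these two
      values differ by [p ^ m * c (p ^ m)] ([comb_step_char]).  Since the
      values of [chi] are integers, by the same lemma applied to
      [a |-> chi (s ^+ a)], the congruence holds in the integers.

    Back to the combinatorial relation, both remaining hypotheses imply that
    [s] and [s'] fix, for every [j], the same number of [j]-element subsets
    modulo [p ^ m].  For the congruence of characters this is the case of the
    permutation character on [j]-element subsets ([char_fixed_subsets]).  For a
    step from [g] to [g * k] with [k := h ^+ (p ^ m.-1)], the subsets fixed by
    [k] contribute equally to both counts, and the others split into orbits of
    [h] whose lengths are powers of [p] that do not divide [p ^ m.-1]
    ([card_fix_mul_pelt]).

    These counts are the coefficients of the product of the [1 + 'X^k] over the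
    cycle lengths [k].  Merging cycles as long as some length occurs at least
    [p ^ m] times preserves all relations and leads to cycle types whose
    multiplicities are smaller than [p ^ m]; such a cycle type is read off the
    product modulo [p ^ m], from the least length upwards
    ([part_poly_inj]). *)

(** * Orbits of a permutation and conjugacy in the symmetric group *)

Section Conjugacy.
Set Implicit Arguments.
Unset Strict Implicit.
Unset Printing Implicit Defensive.
Local Open Scope group_scope.
Local Open Scope nat_scope.

Lemma expgp_fix_dvd (T : finType) (s : {perm T}) (x : T) (i : nat) :
  ((s ^+ i) x == x) = (#|porbit s x| %| i).
Proof.
have perK q : (s ^+ (q * #|porbit s x|)) x = x.
  elim: q => [|q IHq]; first by rewrite mul0n expg0 perm1.
  by rewrite mulSn expgD permM (permX s x #|_|) iter_porbit.
rewrite {1}(divn_eq i #|porbit s x|) expgD permM perK /dvdn.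
have lt_r : i %% #|porbit s x| < #|porbit s x|.
  by rewrite ltn_mod lt0n card_porbit_neq0.
apply/eqP/eqP => [fix_r|->]; last by rewrite expg0 perm1.
have lt0 : 0 < #|porbit s x| by rewrite lt0n card_porbit_neq0.
have := nth_uniq x (i := i %% #|porbit s x|) (j := 0) _ _
  (uniq_traject_porbit s x).
rewrite size_traject => /(_ lt_r lt0); rewrite !nth_traject // -permX fix_r.
by rewrite /= eqxx => /esym/eqP.
Qed.

Lemma expgp_eq_mod (T : finType) (s : {perm T}) (x : T) (i j : nat) :
  ((s ^+ i) x == (s ^+ j) x) = (i == j %[mod #|porbit s x|]).
Proof.
wlog le_ji : i j / j <= i.
  by case/orP: (leq_total j i) => le /(_ _ _ le) // IH; rewrite eq_sym IH eq_sym.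
rewrite eqn_mod_dvd // -expgp_fix_dvd -{1}(subnK le_ji) expgD permM.
by rewrite (inj_eq perm_inj).
Qed.

(** The size of an orbit is determined by the exponents whose powers fix its
    points, so orbit sizes of permutations of different types can be compared
    without exhibiting a bijection between the orbits. *)
Lemma card_porbit_eq (T T' : finType) (s : {perm T}) (s' : {perm T'}) x y :
  (forall i, ((s ^+ i) x == x) = ((s' ^+ i) y == y)) ->
  #|porbit s x| = #|porbit s' y|.
Proof.
move=> eq_fix; apply/eqP; rewrite eqn_dvd -!expgp_fix_dvd.
by apply/andP; split; [rewrite eq_fix | rewrite -eq_fix]; rewrite expgp_fix_dvd.
Qed.

Lemma card_porbitX (T : finType) (s : {perm T}) (x : T) (a : nat) :
  #|porbit (s ^+ a)%g x| = #|porbit s x| %/ gcdn #|porbit s x| a.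
Proof.
set d := #|porbit s x|; have d_gt0 : 0 < d by rewrite lt0n card_porbit_neq0.
have g_gt0 : 0 < gcdn d a by rewrite gcdn_gt0 d_gt0.
suff dvdE j : (#|porbit (s ^+ a)%g x| %| j) = (d %/ gcdn d a %| j).
  by apply/eqP; rewrite eqn_dvd dvdE dvdnn -dvdE dvdnn.
rewrite -expgp_fix_dvd -expgM expgp_fix_dvd -/d.
rewrite -[X in X %| _ * _](divnK (dvdn_gcdl d a)).
rewrite -[X in _ %| X * _](divnK (dvdn_gcdr d a)).
rewrite mulnAC dvdn_pmul2r // Gauss_dvdr //.
rewrite /coprime -(eqn_pmul2r g_gt0) muln_gcdl.
by rewrite !divnK ?dvdn_gcdl ?dvdn_gcdr // mul1n.
Qed.

(** Counting points rather than cycles keeps cycle types additive under disjoint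
    unions and easy to compute for powers; [orbit_countE] converts. *)
Definition orbit_count (T : finType) (s : {perm T}) (k : nat) : nat :=
  #|[set x | #|porbit s x| == k]|.

Lemma mem_porbits (T : finType) (s : {perm T}) C x :
  C \in porbits s -> x \in C -> C = porbit s x.
Proof.
by case/imsetP=> y _ ->; rewrite -eq_porbit_mem => /eqP->.
Qed.

Lemma orbit_countE (n : nat) (s : 'S_n) (k : nat) :
  orbit_count s k = k * count_mem k (cycle_lengths s).
Proof.
rewrite /cycle_lengths (seq.permP (permEl (perm_sort _ _))) count_map.
have -> : orbit_count s k = \sum_(C in porbits s) if #|C| == k then #|C| else 0.
  rewrite /orbit_count -sum1dep_card.
  rewrite (partition_big (porbit s) (mem (porbits s))) /=; last first.
    by move=> x _; apply: imset_f.
  apply: eq_bigr => C C_s; case: eqP => [Ck | Ck]; last first.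
    rewrite big_pred0 // => x; apply/negP => /andP[/eqP kx /eqP eqC].
    by apply: Ck; rewrite -eqC.
  rewrite -sum1_card; apply: eq_bigl => x.
  apply/andP/idP => [[_ /eqP<-]|xC]; first exact: porbit_id.
  by rewrite -(mem_porbits C_s xC) Ck.
rewrite -sum1_count big_distrr big_enum_cond /= [in RHS]big_mkcondr /=.
by apply: eq_bigr => C _; case: eqP => // ->; rewrite muln1.
Qed.

Lemma count_cycle_lengths0 (n : nat) (s : 'S_n) :
  count_mem 0 (cycle_lengths s) = 0.
Proof. by apply/count_memPn; case/and3P: (cycle_lengths_intpart s). Qed.

Lemma perm_cycle_lengths (n : nat) (s : 'S_n) (l : seq nat) :
  0 \notin l -> (forall k, orbit_count s k = k * count_mem k l) ->
  perm_eq (cycle_lengths s) l.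
Proof.
move=> l0 cnt; apply/allP => k _ /=; apply/eqP.
case: k => [|k]; first by rewrite count_cycle_lengths0 (count_memPn l0).
by have := cnt k.+1; rewrite orbit_countE => /eqP; rewrite eqn_pmul2l // => /eqP.
Qed.

Lemma intpart_perm_eq (n n' : nat) (l l' : seq nat) :
  is_intpart_of n l -> is_intpart_of n' l' -> perm_eq l l' -> l = l'.
Proof.
move=> /and3P[srt _ _] /and3P[srt' _ _]; apply: (sorted_eq (leT := geq)) => //.
- by move=> a b c ba cb; apply: leq_trans ba.
- by move=> a b /anti_leq.
Qed.

Lemma eq_cycle_lengths (n n' : nat) (s : 'S_n) (s' : 'S_n') :
  orbit_count s =1 orbit_count s' -> cycle_lengths s = cycle_lengths s'.
Proof.
move=> eq_cnt; have intpart_s' := cycle_lengths_intpart s'.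
apply: (intpart_perm_eq (cycle_lengths_intpart s) intpart_s').
have [_ nz' _] := and3P intpart_s'.
by apply: perm_cycle_lengths => // k; rewrite eq_cnt orbit_countE.
Qed.

(** The cycles of [s] are matched with cycles of [s'] of the same length by
    listing both by size; a point at distance [i] from the chosen base point
    of its cycle goes to the point at distance [i] from the base point of the
    matched cycle. *)
Lemma cycle_lengths_conj (n : nat) (s s' : 'S_n) :
  cycle_lengths s = cycle_lengths s' -> exists t : 'S_n, s' = (s ^ t)%g.
Proof.
case: n s s' => [|n] s s' eq_len.
  by exists 1%g; apply/permP => -[].
pose byc := relpre (fun C : {set 'I_n.+1} => #|C|) geq.
pose L (u : 'S_n.+1) := sort byc (enum (porbits u)).
have lenE u : cycle_lengths u = [seq #|C| | C : {set 'I_n.+1} <- L u].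
  by rewrite /cycle_lengths sort_map.
have memL u C : (C \in L u) = (C \in porbits u) by rewrite mem_sort mem_enum.
have uniqL u : uniq (L u) by rewrite sort_uniq enum_uniq.
have sizeL : size (L s) = size (L s').
  by move/(congr1 size): eq_len; rewrite !lenE !size_map.
(* [phi] matches cycles of equal length: both lists are sorted by size, and
   their lists of sizes are equal. *)
pose phi C := nth set0 (L s') (index C (L s)).
have lt_idx C : C \in porbits s -> index C (L s) < size (L s').
  by rewrite -sizeL index_mem memL.
have phiP C : C \in porbits s -> phi C \in porbits s'.
  by move=> Cs; rewrite -memL mem_nth ?lt_idx.
have card_phi C : C \in porbits s -> #|phi C| = #|C|.
  move=> Cs; have := congr1 (nth 0 ^~ (index C (L s))) eq_len.
  rewrite !lenE !(nth_map set0) ?lt_idx //; last by rewrite sizeL lt_idx.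
  by rewrite nth_index ?memL // => ->.
have inj_phi : {in porbits s &, injective phi}.
  move=> C D Cs Ds /eqP; rewrite nth_uniq ?lt_idx // => /eqP.
  move=> ij; rewrite -(nth_index set0 (s := L s) (x := C)) ?memL //.
  by rewrite ij nth_index ?memL.
pose r (C : {set 'I_n.+1}) := odflt ord0 [pick x in C].
have rP u C : C \in porbits u -> r C \in C.
  move=> Cu; rewrite /r; case: pickP => //= C0.
  by case/imsetP: Cu C0 => x _ -> /(_ x); rewrite porbit_id.
have in_s x : porbit s x \in porbits s by apply: imset_f.
(* [i x] is the distance from the base point of the cycle of [x] to [x]. *)
pose i x := index x (traject s (r (porbit s x)) #|porbit s x|).
have eq_r x : porbit s (r (porbit s x)) = porbit s x.
  by apply/eqP; rewrite eq_porbit_mem (rP s).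
have iP x : (s ^+ i x) (r (porbit s x)) = x.
  have x_tr : x \in traject s (r (porbit s x)) #|porbit s x|.
    by rewrite -{2}eq_r -porbit_traject eq_r porbit_id.
  rewrite permX /i -[RHS](nth_index (r (porbit s x)) x_tr) nth_traject //.
  by move: x_tr; rewrite -index_mem size_traject.
pose F x := (s' ^+ i x) (r (phi (porbit s x))).
have porbF x : porbit s' (F x) = phi (porbit s x).
  by rewrite porbit_perm; apply/esym/mem_porbits; rewrite ?(rP s') ?phiP.
have card_r x : #|porbit s' (r (phi (porbit s x)))| = #|porbit s x|.
  by rewrite -(porbit_perm s' (i x)) porbF card_phi.
have injF : injective F.
  move=> x y Fxy; have Cxy : porbit s x = porbit s y.
    by apply: inj_phi => //; rewrite -!porbF Fxy.
  rewrite -(iP x) -(iP y) Cxy; apply/eqP; rewrite expgp_eq_mod eq_r.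
  rewrite -card_r -expgp_eq_mod; apply/eqP.
  by move: Fxy; rewrite /F Cxy.
have FM x : F (s x) = s' (F x).
  have Csx : porbit s (s x) = porbit s x by have := porbit_perm s 1 x; rewrite expg1.
  rewrite /F Csx -permM -expgSr; apply/eqP; rewrite expgp_eq_mod card_r.
  rewrite -eq_r -expgp_eq_mod -{1}Csx iP expgSr permM iP; exact/eqP.
exists (perm injF); apply/permP => y.
by rewrite -[y](permKV (perm injF)) permJ !permE FM.
Qed.

End Conjugacy.

(** * Juxtaposed permutations and the existence of every cycle type *)

Section Realization.
Set Implicit Arguments.
Unset Strict Implicit.
Unset Printing Implicit Defensive.
Local Open Scope group_scope.
Local Open Scope nat_scope.

Section JuxtaposedPermutations.
Variables a b : nat.

Definition juxt_fun (s : 'S_a) (t : 'S_b) (x : 'I_(a + b)) : 'I_(a + b) :=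
  match split x with inl i => lshift b (s i) | inr j => rshift a (t j) end.

Fact juxt_fun_inj (s : 'S_a) (t : 'S_b) : injective (juxt_fun s t).
Proof.
move=> x y; rewrite /juxt_fun.
case: (splitP x) => i xi; case: (splitP y) => j yj /(congr1 val) /= eq_val;
  apply: val_inj; rewrite /= xi yj.
- by congr val; apply: (@perm_inj _ s); apply: val_inj.
- by move: (ltn_ord (s i)); rewrite eq_val ltnNge leq_addr.
- by move: (ltn_ord (s j)); rewrite -eq_val ltnNge leq_addr.
- by congr (_ + val _); apply: (@perm_inj _ t); apply: val_inj; apply: addnI eq_val.
Qed.

(** The direct sum of two permutations: the block embedding of the product of
    two symmetric groups into a larger one. *)
Definition juxt (s : 'S_a) (t : 'S_b) : 'S_(a + b) := perm (@juxt_fun_inj s t).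

Lemma juxt_l s t i : juxt s t (lshift b i) = lshift b (s i).
Proof. by rewrite permE /juxt_fun (unsplitK (inl i)). Qed.

Lemma juxt_r s t j : juxt s t (rshift a j) = rshift a (t j).
Proof. by rewrite permE /juxt_fun (unsplitK (inr j)). Qed.

Lemma juxtM s t s' t' : juxt (s * s') (t * t') = (juxt s t * juxt s' t')%g.
Proof.
apply/permP => x; rewrite -(splitK x) permM.
by case: (split x) => i; rewrite /unsplit ?juxt_l ?juxt_r permM.
Qed.

Lemma juxt1 : juxt 1 1 = 1%g.
Proof.
apply/permP => x; rewrite -(splitK x) perm1.
by case: (split x) => i; rewrite /unsplit ?juxt_l ?juxt_r perm1.
Qed.

Lemma juxtX s t i : (juxt s t ^+ i)%g = juxt (s ^+ i) (t ^+ i).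
Proof. by elim: i => [|i IHi]; rewrite ?expg0 ?juxt1 // !expgS IHi juxtM. Qed.

Lemma orbit_count_juxt s t k :
  orbit_count (juxt s t) k = orbit_count s k + orbit_count t k.
Proof.
rewrite /orbit_count -!sum1dep_card -[LHS]/(\sum_(x | _) 1) big_split_ord /=.
congr (_ + _); apply: eq_bigl => x; congr (_ == k); apply: card_porbit_eq => i.
  by rewrite juxtX juxt_l (inj_eq (@lshift_inj _ _)).
by rewrite juxtX juxt_r (inj_eq (@rshift_inj _ _)).
Qed.

End JuxtaposedPermutations.

Definition rotation (N : nat) : 'S_N := perm (@ordS_inj N).

Lemma rotationX (N i : nat) (x : 'I_N) :
  (rotation N ^+ i)%g x = (x + i) %% N :> nat.
Proof.
elim: i => [|i IHi]; first by rewrite expg0 perm1 addn0 modn_small.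
by rewrite expgSr permM permE /= IHi -addn1 modnDml addn1 addnS.
Qed.

Lemma rotationX_fix (N i : nat) (x : 'I_N) :
  ((rotation N ^+ i)%g x == x) = (N %| i).
Proof.
rewrite -val_eqE /= rotationX -{2}(modn_small (ltn_ord x)).
by rewrite -{2}[val x]addn0 eqn_modDl mod0n.
Qed.

Lemma card_porbit_rotation (N : nat) (x : 'I_N) : #|porbit (rotation N) x| = N.
Proof.
apply/eqP; rewrite eqn_dvd -expgp_fix_dvd rotationX_fix dvdnn /=.
by rewrite -(rotationX_fix _ x) expgp_fix_dvd.
Qed.

Lemma orbit_count_rotationX (N i k : nat) :
  orbit_count (rotation N ^+ i)%g k = if k == N %/ gcdn N i then N else 0.
Proof.
rewrite /orbit_count; 
under eq_finset => x do rewrite card_porbitX card_porbit_rotation eq_sym.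
by case: ifP => _; rewrite ?cardsT ?card_ord ?cards0.
Qed.

(** One rotation per part, juxtaposed. *)
Lemma cycle_lengths_exist (l : seq nat) :
  0 \notin l ->
  exists s : 'S_(sumn l), forall k, orbit_count s k = k * count_mem k l.
Proof.
elim: l => [|N l IHl] /=.
  by exists 1%g => k; rewrite muln0 /orbit_count; apply: eq_card0 => -[].
rewrite inE negb_or => /andP[N0 /IHl[t cnt_t]].
exists (juxt (rotation N ^+ 1)%g t) => k.
rewrite orbit_count_juxt orbit_count_rotationX cnt_t gcdn1 divn1 eq_sym mulnDr.
by case: eqP => [->|]; rewrite ?muln1 ?muln0.
Qed.

Lemma intpart_inhabited (n : nat) (la : intpart n) :
  exists s : 'S_n, cycle_type s = la.
Proof.
case: la => l la_n; have /and3P[_ l0 /eqP sum_l] := la_n.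
case: n / sum_l la_n => la_n.
have [s cnt_s] := cycle_lengths_exist l0; exists s.
apply/val_inj/(intpart_perm_eq (cycle_lengths_intpart s) la_n).
exact: perm_cycle_lengths.
Qed.

Lemma group_equiv_conj (p m n : nat) (s s' : 'S_n) :
  cycle_lengths s = cycle_lengths s' -> group_equiv p m s s'.
Proof. by case/cycle_lengths_conj => t ->; apply/rst_step/GroupStepConj. Qed.

End Realization.

(** * Merging cycles inside the powers of one long cycle *)

Section Merging.
Set Implicit Arguments.
Unset Strict Implicit.
Unset Printing Implicit Defensive.
Local Open Scope group_scope.
Local Open Scope nat_scope.

Lemma orbit_count_rotation_dvd (k d j : nat) :
  0 < k -> 0 < d ->
  orbit_count (rotation (k * d) ^+ d)%g j = j * count_mem j (nseq d k).
Proof.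
move=> k_gt0 d_gt0; rewrite orbit_count_rotationX (gcdn_idPr (dvdn_mull k (dvdnn d))).
rewrite mulnK // count_nseq /= eq_sym.
by case: eqP => [->|]; rewrite ?mul1n // muln0.
Qed.

(** With [N = k * p ^ m], the power [R ^+ d] of the [N]-cycle [R] consists of
    [d] cycles of length [N %/ d] for each divisor [d] of [N]; the two sides of
    a combinatorial step are the cases [d = p ^ m] and [d = p ^ m.-1]. *)
Lemma comb_step_juxt (p m n : nat) (la mu : intpart n) :
  prime p -> 0 < m -> comb_step p m la mu ->
  exists N b (t : 'S_b), [/\ 0 < N, p ^ m %| N, N + b = n,
    cycle_lengths (juxt (rotation N ^+ (p ^ m)) t) = sval la
  & cycle_lengths (juxt (rotation N ^+ (p ^ m.-1)) t) = sval mu].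
Proof.
move=> p_pr m_gt0 [k [nu [k_gt0 la_k mu_k]]].
have p_gt0 := prime_gt0 p_pr.
have expm : p ^ m = p ^ m.-1 * p by rewrite -expnSr prednK.
have [_ la0 /eqP sum_la] := and3P (svalP la).
have nu0 : 0 \notin nu.
  by move: la0; rewrite (perm_mem la_k) mem_cat negb_or => /andP[].
have [t cnt_t] := cycle_lengths_exist nu0.
exists (k * p ^ m), (sumn nu), t.
have cyc d l : 0 < d -> d * l = k * p ^ m -> 0 < l -> forall ka : intpart n,
    perm_eq (sval ka) (nseq d l ++ nu) ->
  cycle_lengths (juxt (rotation (k * p ^ m) ^+ d) t) = sval ka.
  move=> d_gt0 dl l_gt0 ka ka_l; have [_ ka0 _] := and3P (svalP ka).
  apply: (intpart_perm_eq (cycle_lengths_intpart _) (svalP ka)).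
  apply: perm_cycle_lengths => // j; rewrite orbit_count_juxt cnt_t.
  rewrite -dl mulnC orbit_count_rotation_dvd // -mulnDr -count_cat.
  by rewrite (seq.permP ka_l).
split.
- by rewrite muln_gt0 k_gt0 expn_gt0 p_gt0.
- exact: dvdn_mull.
- by rewrite -sum_la (perm_sumn la_k) sumn_cat sumn_nseq.
- by apply: (cyc _ k); rewrite // ?expn_gt0 ?p_gt0 // mulnC.
- apply: (cyc _ (k * p)); rewrite // ?expn_gt0 ?p_gt0 ?muln_gt0 ?k_gt0 //.
  by rewrite expm mulnCA [_ * p]mulnC.
Qed.

(** A chain of partitions lifts to a chain of permutations, since every
    partition in it is a cycle type. *)
Lemma comb_equiv_sub (p m n : nat) (R : 'S_n -> 'S_n -> Prop) :
  (forall s s', cycle_lengths s = cycle_lengths s' -> R s s') ->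
  (forall s s', R s s' -> R s' s) ->
  (forall s1 s2 s3, R s1 s2 -> R s2 s3 -> R s1 s3) ->
  (forall s s', comb_step p m (cycle_type s) (cycle_type s') -> R s s') ->
  forall s s', comb_equiv p m (cycle_type s) (cycle_type s') -> R s s'.
Proof.
move=> Rrefl Rsym Rtrans Rstep.
suff lift la mu : comb_equiv p m la mu ->
    forall s s', cycle_type s = la -> cycle_type s' = mu -> R s s'.
  by move=> s s' e; apply: lift e _ _ erefl erefl.
elim=> {la mu}.
- by move=> la mu st s s' sla smu; apply: Rstep; rewrite sla smu.
- move=> la s s' sla sla'; apply: Rrefl.
  by have /(congr1 val) := etrans sla (esym sla').
- by move=> la mu _ IH s s' sla smu; apply: Rsym; apply: IH.
- move=> la mu nu _ IH1 _ IH2 s s' sla snu.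
  have [u u_mu] := intpart_inhabited mu.
  by apply: Rtrans (IH1 _ _ sla u_mu) (IH2 _ _ u_mu snu).
Qed.

Lemma rotationX_id (N i : nat) : N %| i -> (rotation N ^+ i = 1)%g.
Proof.
by move=> Ni; apply/permP => x; rewrite perm1; apply/eqP; rewrite rotationX_fix.
Qed.

(** Write [N = p ^ e * M] with [M] prime to [p].  The element [R ^+ u] of a
    cyclic group [<[R]>] of order [N] has order a power of [p] once [M] divides
    [u], and the gcd is the expected one once [u.+1] is [p] modulo [p ^ e]; the
    Chinese remainder theorem provides such a [u]. *)
Lemma exists_mul_pelt_exponent (p m N : nat) :
  prime p -> 0 < m -> 0 < N -> p ^ m %| N ->
  exists e u, N %| u * p ^ e /\ gcdn N (p ^ m.-1 * u.+1) = p ^ m.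
Proof.
move=> p_pr m_gt0 N_gt0 pmN; have p_gt0 := prime_gt0 p_pr.
have [e [M [coMp defN]]] : exists e M, coprime M p /\ N = p ^ e * M.
  case: (pfactor_coprime p_pr N_gt0) => M coM defN.
  by exists (logn p N), M; rewrite coprime_sym mulnC.
have coeM : coprime (p ^ e) M by rewrite coprimeXl // coprime_sym.
pose u := chinese (p ^ e) M p.-1 0.
have Mu : M %| u by rewrite /dvdn chinese_modr // mod0n.
have u_mod : u = p.-1 %[mod p ^ e] by apply: chinese_modl.
exists e, u; split; first by rewrite defN mulnC dvdn_pmul2r // expn_gt0 p_gt0.
have le_me : m <= e.
  move: pmN; rewrite defN Gauss_dvdl ?dvdn_Pexp2l ?prime_gt1 //.
  by rewrite coprimeXl // coprime_sym.
have coMu : coprime M u.+1.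
  by case/dvdnP: Mu => q ->; rewrite /coprime -addn1 gcdnMDl gcdn1.
rewrite defN gcdnC Gauss_gcdl; last first.
  by rewrite coprimeMl coprimeXl 1?coprime_sym.
rewrite gcdnC.
have -> : p ^ e = p ^ m.-1 * p ^ (e - m.-1) by rewrite -expnD; congr (_ ^ _); lia.
rewrite -muln_gcdr.
have -> : p ^ m = p ^ m.-1 * p by rewrite -expnSr prednK.
congr (_ * _); rewrite -gcdn_modr.
have -> : u.+1 = p %[mod p ^ (e - m.-1)].
  have dv : p ^ (e - m.-1) %| p ^ e by rewrite dvdn_exp2l ?leq_subr.
  have u_mod' : u = p.-1 %[mod p ^ (e - m.-1)].
    by rewrite -(modn_dvdm u dv) u_mod modn_dvdm.
  by rewrite -addn1 -modnDml u_mod' modnDml addn1 prednK.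
rewrite gcdn_modr; apply/gcdn_idPr.
by rewrite -{1}(expn1 p) dvdn_exp2l //; lia.
Qed.

Lemma comb_step_group_equiv (p m n : nat) (s s' : 'S_n) :
  prime p -> 0 < m ->
  comb_step p m (cycle_type s) (cycle_type s') -> group_equiv p m s s'.
Proof.
move=> p_pr m_gt0 /(comb_step_juxt p_pr m_gt0)
  [N [b [t [N_gt0 pmN defn len_s len_s']]]].
subst n.
have [e [u [Nu gcd_u]]] := exists_mul_pelt_exponent p_pr m_gt0 N_gt0 pmN.
apply: rst_sym; apply: rst_trans (group_equiv_conj p m (esym len_s')) _.
pose h := juxt (rotation N ^+ u)%g (1%g : 'S_b).
apply: (@rst_trans _ _ _ (juxt (rotation N ^+ (p ^ m.-1)) t * h ^+ (p ^ m.-1))%g).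
  apply/rst_step/GroupStepMul.
    by rewrite /commute -!juxtM mulg1 mul1g -!expgD [u + _]addnC.
  have : (h ^+ (p ^ e) = 1)%g.
    by rewrite juxtX expg1n -expgM rotationX_id // juxt1.
  move/eqP; rewrite -order_dvdn => /(dvdn_pfactor _ _ p_pr)[f _ ->].
  by exists f.
apply: group_equiv_conj; apply: etrans len_s.
apply: eq_cycle_lengths => j.
rewrite juxtX expg1n -juxtM mulg1 -expgM -expgD !orbit_count_juxt.
by rewrite mulnC -mulnS !orbit_count_rotationX (gcdn_idPr pmN) gcd_u.
Qed.

Lemma comb_equiv_group_equiv (p m n : nat) (s s' : 'S_n) :
  prime p -> 0 < m ->
  comb_equiv p m (cycle_type s) (cycle_type s') -> group_equiv p m s s'.
Proof.
move=> p_pr m_gt0; apply: comb_equiv_sub.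
- exact: group_equiv_conj.
- exact: rst_sym.
- exact: rst_trans.
- by move=> u v; apply: comb_step_group_equiv.
Qed.

End Merging.

(** * Counting the subsets fixed by a permutation modulo a prime power *)

Section FixedSubsets.
Set Implicit Arguments.
Unset Strict Implicit.
Unset Printing Implicit Defensive.
Local Open Scope group_scope.
Local Open Scope nat_scope.

(** An orbit of [h] has size [p ^ f], and [p ^ f] does not divide [p ^ m.-1] as
    [h ^+ (p ^ m.-1)] moves its points; hence [p ^ m] divides [p ^ f]. *)
Lemma dvdn_card_free_orbits (p m e : nat) (T : finType) (h : {perm T}) (D : {set T}) :
  prime p -> 0 < m -> (h ^+ (p ^ e) = 1)%g ->
  {in D, forall x, h x \in D} ->
  {in D, forall x, (h ^+ (p ^ m.-1))%g x != x} ->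
  p ^ m %| #|D|.
Proof.
move=> p_pr m_gt0 he hD freeD.
have D_orb x : x \in D -> porbit h x \subset D.
  move=> xD; apply/subsetP => _ /porbitP[i ->].
  elim: i => [|i IHi]; first by rewrite expg0 perm1.
  by rewrite expgSr permM hD.
rewrite -sum1_card (partition_big (porbit h) (mem (porbit h @: D))) /=; last first.
  by move=> x xD; apply: imset_f.
apply: dvdn_sum => _ /imsetP[x xD ->].
have -> : \sum_(y in D | porbit h y == porbit h x) 1 = #|porbit h x|.
  rewrite -sum1_card; apply: eq_bigl => y; rewrite eq_porbit_mem.
  by apply: andb_idl => /(subsetP (D_orb x xD)).
have : #|porbit h x| %| p ^ e by rewrite -expgp_fix_dvd he perm1.
case/(dvdn_pfactor _ _ p_pr)=> f _ cardf.
have := freeD x xD; rewrite expgp_fix_dvd cardf !dvdn_Pexp2l ?prime_gt1 //.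
by rewrite -ltnNge prednK.
Qed.

(** On the points fixed by [k := h ^+ (p ^ m.-1)] the conditions of being fixed
    by [g] and by [g * k] agree; off these points, both fixed sets are unions
    of orbits of [h], to which [dvdn_card_free_orbits] applies. *)
Lemma card_fix_mul_pelt (p m e : nat) (T : finType) (g h : {perm T}) (S : {set T}) :
  prime p -> 0 < m -> commute g h -> (h ^+ (p ^ e) = 1)%g ->
  {in S, forall x, h x \in S} ->
  #|[set x in S | g x == x]|
    = #|[set x in S | (g * h ^+ (p ^ m.-1))%g x == x]| %[mod p ^ m].
Proof.
move=> p_pr m_gt0 cgh he hS; set k := (h ^+ _)%g.
have ghx x : h (g x) = g (h x) by rewrite -!permM cgh.
have gkx x : k (g x) = g (k x) by rewrite -!permM (commuteX _ cgh).
have hkx x : k (h x) = h (k x) by rewrite -!permM (commuteX _ (commute_refl h)).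
pose K := [set x | k x == x].
set F1 := [set x in S | _]; set F2 := [set x in S | _].
have FK : F1 :&: K = F2 :&: K.
  apply/setP => x; rewrite !inE permM gkx -!andbA; congr (_ && _).
  by apply: andb_id2r => /eqP ->.
have dvdF (F : {set T}) : {in F, forall x, h x \in F} -> p ^ m %| #|F :\: K|.
  move=> hF; apply: (dvdn_card_free_orbits p_pr m_gt0 he) => x; rewrite !inE.
    by case/andP=> kx xF; rewrite hF // andbT hkx (inj_eq perm_inj).
  by case/andP.
have /dvdnP[q1 F1K] : p ^ m %| #|F1 :\: K|.
  apply: dvdF => x; rewrite !inE => /andP[xS /eqP gx].
  by rewrite hS // -ghx gx eqxx.
have /dvdnP[q2 F2K] : p ^ m %| #|F2 :\: K|.
  apply: dvdF => x; rewrite !inE !permM => /andP[xS /eqP gx].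
  by rewrite hS // -ghx hkx gx eqxx.
by rewrite -(cardsID K F1) -(cardsID K F2) FK F1K F2K ![_ + _ * _]addnC !modnMDl.
Qed.

Definition subset_perm (n : nat) (s : 'S_n) : {perm {set 'I_n}} :=
  perm (imset_inj (@perm_inj _ s)).

Lemma subset_permE n (s : 'S_n) A : subset_perm s A = s @: A.
Proof. by rewrite permE. Qed.

Lemma subset_permM n (s t : 'S_n) :
  subset_perm (s * t) = (subset_perm s * subset_perm t)%g.
Proof.
apply/permP => A; rewrite permM !subset_permE -imset_comp.
by apply: eq_imset => x; rewrite permM.
Qed.

Lemma subset_perm1 n : subset_perm (1 : 'S_n) = 1%g.
Proof.
apply/permP => A; rewrite perm1 subset_permE -[RHS]imset_id.
by apply: eq_imset => x; rewrite perm1.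
Qed.

Lemma subset_permX n (s : 'S_n) i : subset_perm (s ^+ i) = (subset_perm s ^+ i)%g.
Proof.
by elim: i => [|i IHi]; rewrite ?expg0 ?subset_perm1 // !expgS subset_permM IHi.
Qed.

Definition fixed_subsets (n : nat) (s : 'S_n) (j : nat) : nat :=
  #|[set A in [set A : {set 'I_n} | #|A| == j] | subset_perm s A == A]|.

Lemma fixed_subsets_conj n (s t : 'S_n) j :
  fixed_subsets (s ^ t) j = fixed_subsets s j.
Proof.
rewrite /fixed_subsets -[RHS](card_imset _ (@perm_inj _ (subset_perm t))).
apply: eq_card => A; rewrite -[A](permKV (subset_perm t)).
rewrite (mem_imset _ _ (@perm_inj _ _)) !inE.
move: ((subset_perm t)^-1%g A) => B; congr (_ && _).
  by rewrite subset_permE card_imset //; apply: perm_inj.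
rewrite -permM -subset_permM -conjgC subset_permM permM.
exact: inj_eq perm_inj _ _.
Qed.

Lemma fixed_subsets_group_equiv (p m n : nat) (s s' : 'S_n) (j : nat) :
  prime p -> 0 < m -> group_equiv p m s s' ->
  fixed_subsets s j = fixed_subsets s' j %[mod p ^ m].
Proof.
move=> p_pr m_gt0; elim=> {s s'} [s s' | // | // | s1 s2 s3 _ -> //].
case=> [g x | g h cgh [e oh]]; first by rewrite fixed_subsets_conj.
rewrite /fixed_subsets subset_permM subset_permX.
apply: (card_fix_mul_pelt (e := e)) => //.
- by rewrite /commute -!subset_permM cgh.
- by rewrite -subset_permX -oh expg_order subset_perm1.
by move=> A; rewrite !inE subset_permE card_imset //; apply: perm_inj.
Qed.

End FixedSubsets.

(** * The generating function of the fixed subsets determines reduced cycle types *)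

Section GeneratingFunction.
Set Implicit Arguments.
Unset Strict Implicit.
Unset Printing Implicit Defensive.
Local Open Scope group_scope.
Local Open Scope nat_scope.
Local Open Scope ring_scope.

(** The generating function of the sub-multisets of [l] by their sum. *)
Definition part_poly (R : comNzRingType) (l : seq nat) : {poly R} :=
  \prod_(k <- l) (1 + 'X^k).

Lemma fixed_subset_cover n (s : 'S_n) (A : {set 'I_n}) :
  s @: A = A -> cover [set C in porbits s | C \subset A] = A.
Proof.
move=> sA; apply/eqP; rewrite eqEsubset; apply/andP; split.
  by apply/bigcupsP => C; rewrite inE => /andP[].
apply/subsetP => x xA; apply/bigcupP; exists (porbit s x); last exact: porbit_id.
rewrite inE imset_f //=; apply/subsetP => _ /porbitP[i ->].
elim: i => [|i IHi]; first by rewrite expg0 perm1.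
by rewrite expgSr permM -sA imset_f.
Qed.

Lemma cover_fixed_subset n (s : 'S_n) (J : {set {set 'I_n}}) :
  J \subset porbits s -> s @: cover J = cover J.
Proof.
move=> Js; apply/eqP; rewrite eqEcard card_imset ?leqnn ?andbT; last exact: perm_inj.
apply/subsetP => _ /imsetP[x /bigcupP[C CJ xC] ->].
apply/bigcupP; exists C => //; have Cs := subsetP Js C CJ.
by rewrite (mem_porbits Cs xC); have := mem_porbit s 1 x; rewrite expg1.
Qed.

Lemma cover_porbitsK n (s : 'S_n) (J : {set {set 'I_n}}) :
  J \subset porbits s -> [set C in porbits s | C \subset cover J] = J.
Proof.
move=> Js; apply/setP => C; rewrite inE.
apply/andP/idP => [[Cs CJ]|CJ]; last by rewrite (subsetP Js) ?bigcup_sup.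
have [x _ defC] := imsetP Cs.
have xC : x \in C by rewrite defC porbit_id.
have /bigcupP[D DJ xD] := subsetP CJ x xC.
by rewrite (mem_porbits Cs xC) -(mem_porbits (subsetP Js D DJ) xD).
Qed.

Lemma card_cover_porbits n (s : 'S_n) (J : {set {set 'I_n}}) :
  J \subset porbits s -> #|cover J| = (\sum_(C in J) #|C|)%N.
Proof.
move=> Js; apply/esym/eqP; apply/trivIsetP => C D CJ DJ.
apply: contraR => /pred0Pn[x /andP[/= xC xD]].
by rewrite (mem_porbits (subsetP Js C CJ) xC) (mem_porbits (subsetP Js D DJ) xD).
Qed.

(** A fixed subset is the union of the cycles that it contains, so choosing a
    fixed subset is choosing a set of cycles, that is, one of the two terms in
    each factor of the product. *)
Lemma part_poly_fixed_subsets (R : comNzRingType) n (s : 'S_n) :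
  part_poly R (cycle_lengths s) = \sum_(A : {set 'I_n} | s @: A == A) 'X^#|A|.
Proof.
rewrite /part_poly (perm_big _ (permEl (perm_sort _ _))) big_map big_enum /=.
rewrite big_mkcond /=.
(* Sets that are not cycles get the factor [0 + 1], so that the product runs
   over all sets and the sum over all sets of sets. *)
pose F (C : {set 'I_n}) : {poly R} := if C \in porbits s then 'X^#|C| else 0.
rewrite (eq_bigr (fun C => F C + 1)); last first.
  by move=> C _; rewrite /F; case: ifP => _; rewrite ?add0r // addrC.
rewrite bigA_distr (bigID (fun J : {set {set 'I_n}} => J \subset porbits s)) /=.
rewrite addrC big1 ?add0r; last first.
  move=> J /subsetPn[C CJ nCs]; rewrite (bigD1 C) //= CJ /F (negbTE nCs).
  by rewrite mul0r.
rewrite [RHS](reindex_onto (@cover _) (fun A => [set C in porbits s | C \subset A]));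
  last by move=> A /eqP; apply: fixed_subset_cover.
apply: eq_big => J /=.
  apply/idP/andP => [Js | [_ /eqP <-]].
    by rewrite cover_fixed_subset // cover_porbitsK.
  by apply/subsetP => C; rewrite inE => /andP[].
move=> Js; rewrite (card_cover_porbits Js) expr_sum.
rewrite -big_mkcond /=; apply: eq_bigr => C CJ.
by rewrite /F (subsetP Js).
Qed.

Lemma coef_part_poly (R : comNzRingType) n (s : 'S_n) j :
  (part_poly R (cycle_lengths s))`_j = (fixed_subsets s j)%:R.
Proof.
rewrite part_poly_fixed_subsets coef_sum /fixed_subsets -sum1dep_card natr_sum.
rewrite big_mkcond [RHS]big_mkcond; apply: eq_bigr => A _.
rewrite coefXn !inE subset_permE andbC eq_sym.
by rewrite [j == _]eq_sym; case: (A == _); case: (#|A| == j).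
Qed.

Lemma coef_part_poly_ge (R : comNzRingType) (k : nat) (l : seq nat) :
  (0 < k)%N -> all (leq k) l ->
  (forall i, (i < k)%N -> (part_poly R l)`_i = (i == 0)%:R)
  /\ (part_poly R l)`_k = (count_mem k l)%:R.
Proof.
move=> k_gt0; rewrite /part_poly; elim: l => [_|x l IHl /= /andP[le_kx /IHl[IH IHk]]].
  by rewrite big_nil; split=> [i _|]; rewrite coef1 // gtn_eqF.
rewrite big_cons; split=> [i lt_ik|]; rewrite mulrDl mul1r coefD coefXnM.
  by rewrite (leq_trans lt_ik le_kx) addr0 IH.
rewrite IHk natrD addrC; congr (_ + _).
by case: ltngtP le_kx => // <- _; rewrite subnn IH.
Qed.

Lemma coef0_part_poly (R : comNzRingType) (l : seq nat) :
  0%N \notin l -> (part_poly R l)`_0 = 1.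
Proof.
move=> l0; have l_pos : all (leq 1) l by apply/allP => -[|//]; rewrite (negPf l0).
by rewrite (proj1 (coef_part_poly_ge R (ltnSn 0) l_pos)).
Qed.

Lemma natr_Zp_inj (q a b : nat) :
  (1 < q)%N -> (a < q)%N -> (b < q)%N -> a%:R = b%:R :> 'Z_q -> a = b.
Proof.
move=> q_gt1 aq bq /(congr1 val); rewrite /= !val_Zp_nat //.
by rewrite !modn_small.
Qed.

(** The product restricted to the parts smaller than [k] is known by induction,
    and the other factors contribute [1 + a 'X^k] up to higher degree, where
    [a] is the multiplicity of [k].  So the coefficient of ['X^k] gives [a]
    modulo [q], and [a < q]. *)
Lemma part_poly_inj (q : nat) (l l' : seq nat) :
  (1 < q)%N -> 0%N \notin l -> 0%N \notin l' ->
  (forall k, count_mem k l < q)%N -> (forall k, count_mem k l' < q)%N ->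
  part_poly 'Z_q l = part_poly 'Z_q l' -> perm_eq l l'.
Proof.
set Q := part_poly 'Z_q; move=> q_gt1 l0 l0' lq lq' eq_poly.
suff eq_cnt k : count_mem k l = count_mem k l' by apply/allP => k _; apply/eqP.
elim/ltn_ind: k => -[_|k IHk]; first by rewrite !(count_memPn _).
pose lo r := [seq x <- r | (x < k.+1)%N]; pose hi r := [seq x <- r | (k.+1 <= x)%N].
have split r : Q r = Q (lo r) * Q (hi r).
  rewrite /Q /part_poly /lo /hi !big_filter (bigID (fun x => x < k.+1)%N) /=.
  by congr (_ * _); apply: eq_bigl => x; rewrite -leqNgt.
have lo_perm : perm_eq (lo l) (lo l').
  apply/allP => x _; apply/eqP; rewrite /= !count_filter.
  case: (ltnP x k.+1) => [lt_xk|le_kx].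
    have eqx r : count (predI (pred1 x) (fun x => x < k.+1)%N) r = count_mem x r.
      by apply: eq_count => y /=; apply: andb_idr => /eqP ->.
    by rewrite !eqx IHk.
  have eqx r : count (predI (pred1 x) (fun x => x < k.+1)%N) r = 0%N.
    rewrite (eq_count (a2 := pred0)) ?count_pred0 // => y /=.
    by apply/andP => -[/eqP ->]; rewrite ltnNge le_kx.
  by rewrite !eqx.
have coefk r : 0%N \notin r -> (Q r)`_k.+1
    = (Q (lo r))`_k.+1 + (count_mem k.+1 r)%:R.
  move=> r0; have [//||lo_i hi_k] := @coef_part_poly_ge 'Z_q k.+1 (hi r).
    exact: filter_all.
  rewrite split coefM big_ord_recr big_ord_recl /= subn0 subnn (lo_i 0%N) // mulr1.
  rewrite [(Q (hi r))`_k.+1]hi_k [(Q (lo r))`_0]coef0_part_poly ?mul1r; last first.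
    by rewrite mem_filter (negPf r0) andbF.
  rewrite big1 ?addr0; last first.
    move=> i _; have lt_ik := ltn_ord i.
    by rewrite lo_i /= /bump; [rewrite gtn_eqF ?mulr0 //; lia | lia].
  rewrite addrC; congr (_ + _%:R); rewrite count_filter; apply: eq_count => y /=.
  by apply: andb_idr => /eqP ->.
have lo_eq : Q (lo l) = Q (lo l') by apply: perm_big.
have eq_k : (Q l)`_k.+1 = (Q l')`_k.+1 by rewrite eq_poly.
rewrite (coefk _ l0) (coefk _ l0') lo_eq in eq_k.
exact: (natr_Zp_inj q_gt1 (lq _) (lq' _) (addrI _ eq_k)).
Qed.

End GeneratingFunction.

Section ReducedCycleTypes.
Set Implicit Arguments.
Unset Strict Implicit.
Unset Printing Implicit Defensive.
Local Open Scope group_scope.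
Local Open Scope nat_scope.

(** Each merging step lowers the number of parts, so the process stops. *)
Lemma comb_equiv_reduced (p m n : nat) (la : intpart n) :
  prime p -> 0 < m ->
  exists2 mu : intpart n, comb_equiv p m la mu
    & forall k, count_mem k (sval mu) < p ^ m.
Proof.
move=> p_pr m_gt0; have p_gt1 := prime_gt1 p_pr; have p_gt0 := prime_gt0 p_pr.
have [r] := ubnP (size (sval la)); elim: r la => // r IHr la size_la.
have [red | ] := boolP (all (fun k => count_mem k (sval la) < p ^ m) (sval la)).
  exists la; first exact: rst_refl.
  move=> k; have [/(allP red) // | /count_memPn ->] := boolP (k \in sval la).
  by rewrite expn_gt0 p_gt0.
case/allPn=> k k_la; rewrite -leqNgt => le_k.
have [_ la0 /eqP sum_la] := and3P (svalP la).
have k_gt0 : 0 < k by rewrite lt0n; apply: contraNneq la0 => <-.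
pose nu := nseq (count_mem k (sval la) - p ^ m) k ++ [seq x <- sval la | x != k].
have la_nu : perm_eq (sval la) (nseq (p ^ m) k ++ nu).
  rewrite catA -nseqD subnKC //.
  rewrite perm_sym -(permPr (permEl (perm_filterC (pred1 k) _))) perm_cat2r.
  have /all_pred1P -> := filter_all (pred1 k) (sval la).
  by rewrite size_filter.
have expm : p ^ m = p ^ m.-1 * p by rewrite -expnSr prednK.
pose l := sort geq (nseq (p ^ m.-1) (k * p) ++ nu).
have l_nu : perm_eq l (nseq (p ^ m.-1) (k * p) ++ nu) by rewrite perm_sort.
have l_n : is_intpart_of n l.
  apply/and3P; split.
  - by apply: sort_sorted => a b; apply: leq_total.
  - rewrite (perm_mem l_nu) mem_cat mem_nseq negb_or; apply/andP; split.
      by rewrite negb_and eq_sym -lt0n muln_gt0 k_gt0 p_gt0 orbT.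
    by move: la0; rewrite (perm_mem la_nu) mem_cat negb_or => /andP[].
  - rewrite (perm_sumn l_nu) -sum_la (perm_sumn la_nu) !sumn_cat !sumn_nseq expm.
    by apply/eqP; congr (_ + _); rewrite -mulnA [p * _]mulnC.
case: (IHr (exist _ l l_n)) => [/=|mu l_mu mu_red].
  rewrite ltnS in size_la; apply: leq_trans size_la.
  rewrite (perm_size l_nu) (perm_size la_nu).
  by rewrite !size_cat !size_nseq ltn_add2r expm -[X in X < _]muln1
     ltn_pmul2l // expn_gt0 p_gt0.
exists mu => //; apply: rst_trans l_mu.
by apply: rst_step; exists k, nu; split.
Qed.

Lemma comb_equiv_fixed_subsets (p m n : nat) (s s' : 'S_n) :
  prime p -> 0 < m ->
  (forall j, fixed_subsets s j = fixed_subsets s' j %[mod p ^ m]) ->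
  comb_equiv p m (cycle_type s) (cycle_type s').
Proof.
move=> p_pr m_gt0 eq_fix.
have q_gt1 : 1 < p ^ m by rewrite -(exp1n m) ltn_exp2r ?prime_gt1.
have normal (u : 'S_n) : exists v : 'S_n,
    [/\ comb_equiv p m (cycle_type u) (cycle_type v),
        forall j, fixed_subsets u j = fixed_subsets v j %[mod p ^ m]
      & forall k, count_mem k (cycle_lengths v) < p ^ m].
  have [mu u_mu mu_red] := comb_equiv_reduced (cycle_type u) p_pr m_gt0.
  have [v v_mu] := intpart_inhabited mu; rewrite -v_mu in u_mu.
  exists v; split=> // [j|k]; last first.
    by rewrite -[cycle_lengths v]/(sval (cycle_type v)) v_mu.
  exact/fixed_subsets_group_equiv/comb_equiv_group_equiv.
have [[v [sv svj v_red]] [v' [sv' svj' v_red']]] := (normal s, normal s').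
suff eq_v : cycle_type v = cycle_type v'.
  by apply: rst_trans sv _; rewrite eq_v; apply: rst_sym.
have part_v := cycle_lengths_intpart v; have part_v' := cycle_lengths_intpart v'.
apply/val_inj/(intpart_perm_eq part_v part_v').
have [[_ nz _] [_ nz' _]] := (and3P part_v, and3P part_v').
apply: (part_poly_inj q_gt1) => //; apply/polyP => j; rewrite !coef_part_poly.
by apply: val_inj; rewrite /= !val_Zp_nat // -svj -svj' eq_fix.
Qed.

End ReducedCycleTypes.

Section SubsetCharacters.
Set Implicit Arguments.
Unset Strict Implicit.
Unset Printing Implicit Defensive.
Local Open Scope group_scope.
Local Open Scope nat_scope.
Local Open Scope ring_scope.

(** The permutation character of the action on [j]-element subsets. *)
Lemma fixed_subsets_char (n j : nat) :
  exists2 chi : 'CF([set: 'S_n]), chi \is a character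
    & forall s, chi s = (fixed_subsets s j)%:R.
Proof.
pose D := [set A : {set 'I_n} | #|A| == j].
have Dstab (s : 'S_n) A : A \in D -> subset_perm s A \in D.
  by rewrite !inE subset_permE card_imset //; apply: perm_inj.
pose rho (s : 'S_n) : 'M[algC]_#|D| :=
  \matrix_(i, k) (subset_perm s (enum_val i) == enum_val k)%:R.
have rho1 : rho 1%g = 1%:M.
  apply/matrixP => i k; rewrite !mxE subset_perm1 perm1 (inj_eq enum_val_inj).
  by [].
have rhoM : {in [set: 'S_n] &, {morph rho : s t / (s * t)%g >-> s *m t}}.
  move=> s t _ _; apply/matrixP => i k; rewrite !mxE subset_permM permM.
  have DA : subset_perm s (enum_val i) \in D by rewrite Dstab ?enum_valP.
  rewrite (bigD1 (enum_rank_in DA (subset_perm s (enum_val i)))) //= !mxE.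
  rewrite enum_rankK_in // eqxx mul1r big1 ?addr0 // => l nl.
  rewrite !mxE; case: eqP => [eql|]; last by rewrite mul0r.
  by case/eqP: nl; apply: enum_val_inj; rewrite enum_rankK_in // eql.
pose rG := MxRepresentation (conj rho1 rhoM : mx_repr [set: 'S_n]%G rho).
exists (cfRepr rG); first exact: cfRepr_char.
move=> s; rewrite cfunE inE mulr1n /mxtrace /fixed_subsets -sum1dep_card natr_sum.
rewrite [RHS]big_mkcondr [RHS]big_enum_val /=.
by apply: eq_bigr => i _; rewrite mxE; case: eqP.
Qed.

Lemma char_fixed_subsets (p m n : nat) (s s' : 'S_n) :
  (forall chi : 'CF([set: 'S_n]), chi \is a character ->
     (chi s == chi s' %[mod (p ^ m)%N])%C) ->
  forall j, fixed_subsets s j = fixed_subsets s' j %[mod p ^ m].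
Proof.
move=> eq_chi j; have [chi chiP chiE] := fixed_subsets_char n j.
by have := eq_chi chi chiP; rewrite !chiE eqCmod_nat => /eqP.
Qed.

End SubsetCharacters.

(** * Functions on a cyclic group that depend only on the gcd *)

Section GcdFunctions.
Set Implicit Arguments.
Unset Strict Implicit.
Unset Printing Implicit Defensive.
Local Open Scope group_scope.
Local Open Scope nat_scope.
Local Open Scope ring_scope.

(** Moebius inversion, solved recursively instead of through the Moebius
    function; the bound [n] makes the recursion an ordinary induction. *)
Lemma divisor_sum_inversion (V : zmodType) (f : nat -> V) (n : nat) :
  exists c : nat -> V, forall d, (0 < d <= n)%N -> f d = \sum_(e <- divisors d) c e.
Proof.
elim: n => [|n [c cP]].
  by exists (fun=> 0) => d; rewrite lt0n leqn0 => /andP[/negPf->].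
pose r := \sum_(e <- divisors n.+1 | e != n.+1) c e.
exists (fun e => if e == n.+1 then f n.+1 - r else c e) => d /andP[d_gt0].
rewrite leq_eqVlt => /predU1P[->|lt_dn].
  rewrite (bigD1_seq n.+1) ?divisors_uniq -?dvdn_divisors //= eqxx.
  under eq_bigr => e /negPf-> do [].
  by rewrite subrK.
rewrite cP ?d_gt0 //; apply: eq_big_seq => e.
rewrite -dvdn_divisors // => /(dvdn_leq d_gt0) le_ed.
by rewrite ltn_eqF // (leq_ltn_trans le_ed).
Qed.

Lemma sum_prim_root_expM (R : idomainType) (N : nat) (w : R) (y : nat) :
  N.-primitive_root w ->
  \sum_(i < N) w ^+ (i * y) = if (N %| y)%N then N%:R else 0.
Proof.
move=> prim_w; rewrite (eq_bigr (fun i : 'I_N => (w ^+ y) ^+ i)); last first.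
  by move=> i _; rewrite -exprM mulnC.
rewrite (prim_order_dvd prim_w); case: eqP => [-> | /eqP w_neq1].
  by rewrite (eq_bigr (fun=> 1)) ?sumr_const ?card_ord // => i _; rewrite expr1n.
apply/eqP; move: w_neq1; rewrite -subr_eq0 => /mulfI/inj_eq <-.
by rewrite -subrX1 mulr0 exprAC (prim_expr_order prim_w) expr1n subrr.
Qed.

Lemma big_ord_multiples (V : zmodType) (N e : nat) (f : nat -> V) :
  (0 < N)%N -> (e %| N)%N ->
  \sum_(a < N | (e %| a)%N) f a = \sum_(i < N %/ e) f (i * e)%N.
Proof.
move=> N_gt0 eN; have e_gt0 := dvdn_gt0 N_gt0 eN.
rewrite -(big_mkord (fun a => e %| a)%N f) -{1}(divnK eN).
elim: (N %/ e)%N => [|q IHq]; first by rewrite big_ord0 big_geq.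
rewrite big_ord_recr /= -IHq.
rewrite (@big_cat_nat _ _ _ (q * e)%N) /= ?leq_mul2r ?leqnSn ?orbT //.
congr (_ + _); rewrite big_ltn_cond ?ltn_mul2r ?e_gt0 ?ltnSn //.
rewrite dvdn_mull // big_nat_cond big1 ?addr0 // => a.
case/andP=> /andP[lo hi] /dvdnP[k def_a].
by move: lo hi; rewrite def_a !ltn_mul2r => /andP[_ lo] /andP[_]; lia.
Qed.

(** Moebius inversion writes [F a] as the sum of [g e] over the common divisors
    [e] of [N] and [a]; what has to be shown is that [g e] is [e] times an
    element [c e] of [S].  Fourier inversion turns this expansion into
    [dual]: the sum of [c e] over the [e] with [N] dividing [e * y] is a sum of
    values of [b].  For [y = N %/ d] the condition on [e] is that [d] divides
    [e], so [c d] is in [S] by descending induction on the divisor [d]. *)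
Lemma gcd_fourier_coef (N : nat) (w : algC) (S : zmodClosed algC) (F b : nat -> algC) :
  (0 < N)%N -> N.-primitive_root w ->
  (forall x, b x \in S) ->
  (forall a, F a = \sum_(x < N) b x * w ^+ (x * a)) ->
  (forall a, F a = F (gcdn N a)) ->
  exists2 c : nat -> algC, (forall e, c e \in S)
    & forall a, F a = \sum_(e <- divisors N | (e %| a)%N) e%:R * c e.
Proof.
move=> N_gt0 prim_w bS Fb Fgcd.
have [g gP] := divisor_sum_inversion F N.
have FE a : F a = \sum_(e <- divisors N | (e %| a)%N) g e.
  have d_gt0 : (0 < gcdn N a)%N by rewrite gcdn_gt0 N_gt0.
  rewrite Fgcd gP; last by rewrite d_gt0 dvdn_leq ?dvdn_gcdl.
  rewrite -[RHS]big_filter.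
  apply: perm_big; apply: uniq_perm; rewrite ?filter_uniq ?divisors_uniq //.
  by move=> e; rewrite mem_filter -!dvdn_divisors // dvdn_gcd andbC.
pose c e := g e / e%:R.
have e_neq0 e : (e %| N)%N -> e%:R != 0 :> algC.
  by move=> eN; rewrite pnatr_eq0 -lt0n (dvdn_gt0 N_gt0).
have dual y : \sum_(e <- divisors N | (N %| e * y)%N) c e
             = \sum_(x < N | (N %| x + y)%N) b x.
  have N_neq0 : N%:R != 0 :> algC by apply: e_neq0.
  apply: (mulfI N_neq0).
  transitivity (\sum_(a < N) F a * w ^+ (a * y)).
    under [RHS]eq_bigr => a _ do rewrite FE big_distrl /= big_mkcond.
    rewrite exchange_big big_distrr /= [LHS]big_mkcond.
    apply: eq_big_seq => e; rewrite -dvdn_divisors // => eN.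
    rewrite -big_mkcond -big_distrr /=.
    rewrite (big_ord_multiples (fun a => w ^+ (a * y))) //.
    have prim_we : (N %/ e)%N.-primitive_root (w ^+ e).
      have dvN : (N %/ e %| N)%N by apply/dvdnP; exists e; rewrite mulnC divnK.
      by have := dvdn_prim_root prim_w dvN; rewrite divnA // mulKn.
    have := sum_prim_root_expM y prim_we.
    under eq_bigr => i _ do rewrite -exprM mulnCA mulnA.
    move=> ->.
    have -> : (N %/ e %| y)%N = (N %| e * y)%N.
      by rewrite -(@dvdn_pmul2l e) ?(dvdn_gt0 N_gt0) // mulnC divnK.
    case: ifP => _; rewrite ?mulr0 // /c.
    by rewrite -{1}(divnK eN) natrM; field; apply: e_neq0.
  under eq_bigr => a _ do rewrite Fb big_distrl /=.
  rewrite exchange_big big_distrr /= [RHS]big_mkcond /=.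
  apply: eq_bigr => x _.
  under eq_bigr => a _ do rewrite -mulrA -exprD [(x * _)%N]mulnC -mulnDr.
  rewrite -big_distrr /= (sum_prim_root_expM _ prim_w).
  by case: ifP => _; rewrite ?mulr0 // mulrC.
have cS d : (d %| N)%N -> c d \in S.
  have [k] := ubnP (N - d); elim: k d => // k IHk d lt_k dN.
  have d_gt0 := dvdn_gt0 N_gt0 dN.
  have dvd_d e : (N %| e * (N %/ d))%N = (d %| e)%N.
    rewrite -{1}(divnK dN) mulnC dvdn_pmul2r //.
    by rewrite divn_gt0 // dvdn_leq.
  have := dual (N %/ d)%N; under eq_bigl => e do rewrite dvd_d.
  rewrite -[X in X = _]big_filter (bigD1_seq d) ?filter_uniq ?divisors_uniq //=;
    last by rewrite mem_filter dvdnn -dvdn_divisors.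
  rewrite big_filter_cond; move/(canRL (addrK _)) => ->.
  apply: rpredB; first exact: rpred_sum.
  rewrite big_seq_cond; apply: rpred_sum => e; rewrite -dvdn_divisors //.
  case/and3P=> eN de ne; apply: IHk => //.
  have le_de := dvdn_leq (dvdn_gt0 N_gt0 eN) de.
  by have := dvdn_leq N_gt0 eN; lia.
exists (fun e => if (e %| N)%N then c e else 0) => [e|a].
  by case: ifP => [eN|_]; [apply: cS | apply: rpred0].
rewrite FE [LHS]big_seq_cond [RHS]big_seq_cond; apply: eq_bigr => e.
rewrite -dvdn_divisors // => /andP[eN _].
by rewrite eN /c mulrC divfK ?e_neq0.
Qed.

End GcdFunctions.

(** * Congruences between character values *)

Section CharacterValues.
Set Implicit Arguments.
Unset Strict Implicit.
Unset Printing Implicit Defensive.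
Local Open Scope group_scope.
Local Open Scope nat_scope.
Local Open Scope ring_scope.

(** The restriction of [chi] to the abelian group generated by [g] and [c] is a
    sum of linear characters, whose values at [g] are [N]-th roots of unity;
    [b x] collects those that take the value [w ^+ x], weighted by their values
    at [c]. *)
Lemma char_commuting_fourier (gT : finGroupType) (G : {group gT}) (chi : 'CF(G))
    (g c : gT) (N : nat) (w : algC) :
  chi \is a character -> g \in G -> c \in G -> commute g c ->
  (g ^+ N = 1)%g -> N.-primitive_root w ->
  exists b : nat -> algC,
    [/\ forall x, b x \in Aint, c = 1%g -> forall x, b x \in Num.int
      & forall a, chi (g ^+ a * c)%g = \sum_(x < N) b x * w ^+ (x * a)].
Proof.
move=> chi_char gG cG cgc gN prim_w.
pose A := <<[set g; c]>>%G.
have gA : g \in A by rewrite mem_gen // !inE eqxx.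
have cA : c \in A by rewrite mem_gen // !inE eqxx orbT.
have sAG : A \subset G.
  by rewrite gen_subG; apply/subsetP => x /set2P[]->.
have abA : abelian A.
  rewrite abelian_gen; apply/centsP => x /set2P[]-> y /set2P[]->;
    [exact: commute_refl | exact: cgc | exact: commute_sym | exact: commute_refl].
have lin i : 'chi[A]_i \is a linear_char by apply/char_abelianP.
have /fin_all_exists[idx idxP] (i : Iirr A) : exists x : 'I_N, 'chi_i g = w ^+ x.
  have root_i : 'chi_i g ^+ N = 1 by rewrite -(lin_charX (lin i)) // gN lin_char1.
  by have [x ->] := prim_rootP prim_w root_i; exists x.
pose n i := '['Res[A] chi, 'chi_i].
have nN i : n i \in Num.nat by apply: Cnat_cfdot_char_irr; apply: cfRes_char.
exists (fun x => \sum_(i | idx i == x :> nat) n i * 'chi_i c); split.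
- move=> x; apply: rpred_sum => i _.
  by rewrite rpredM ?Aint_irr // Aint_Cnat.
- move=> -> x; apply: rpred_sum => i _.
  by rewrite lin_char1 // mulr1; apply: intr_nat.
move=> a; have gcA : (g ^+ a * c)%g \in A by rewrite groupM ?groupX.
rewrite -(cfResE chi sAG gcA) [in LHS](cfun_sum_cfdot ('Res[A] chi)) sum_cfunE.
rewrite (partition_big idx xpredT) //=; apply: eq_bigr => x _.
rewrite big_distrl /=; apply: eq_big => [i|i /eqP idx_i]; first by rewrite -val_eqE.
rewrite cfunE (lin_charM (lin i)) ?groupX // (lin_charX (lin i)) // idxP idx_i.
by rewrite -exprM mulrA mulrAC.
Qed.

Lemma char_cycle_lengths (n : nat) (chi : 'CF([set: 'S_n])) (s s' : 'S_n) :
  cycle_lengths s = cycle_lengths s' -> chi s = chi s'.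
Proof. by case/cycle_lengths_conj => t ->; rewrite cfunJ ?inE. Qed.

(** The power [s ^+ a] has the cycle type of [s ^+ gcdn #[s] a], so
    [a |-> chi (s ^+ a)] falls under [gcd_fourier_coef], with eigenvalue
    multiplicities as Fourier coefficients. *)
Lemma Cint_char_Sn (n : nat) (chi : 'CF([set: 'S_n])) (s : 'S_n) :
  chi \is a character -> chi s \in Num.int.
Proof.
move=> chi_char; have N_gt0 := order_gt0 s.
have [w prim_w] := C_prim_root_exists N_gt0.
have [b [_ bZ bE]] := char_commuting_fourier chi_char (in_setT s) (in_setT 1%g)
  (commute1 s) (expg_order s) prim_w.
have chi_gcd a : chi (s ^+ a * 1)%g = chi (s ^+ gcdn #[s] a * 1)%g.
  rewrite !mulg1; apply/char_cycle_lengths/eq_cycle_lengths => k.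
  apply: eq_card => x; rewrite !inE !card_porbitX; congr (_ %/ _ == k)%N.
  have dvN : (#|porbit s x| %| #[s])%N by rewrite -expgp_fix_dvd expg_order perm1.
  by rewrite gcdnA (gcdn_idPl dvN).
pose Zint := GRing.ZmodClosed.clone algC (@Num.int_num_subdef algC) _.
have [c cZ cE] := gcd_fourier_coef (S := Zint) N_gt0 prim_w (bZ erefl) bE chi_gcd.
have := cE 1%N; rewrite expg1 mulg1 => ->.
by apply: rpred_sum => e _; rewrite rpredM ?rpred_nat.
Qed.

(** By [comb_step_juxt] and [gcd_fourier_coef], the two values are sums over the
    divisors of [p ^ m] and of [p ^ m.-1]; these differ in the single term
    [p ^ m * c (p ^ m)].  Rationality of the values turns the congruence of
    algebraic integers into one of integers. *)
Lemma comb_step_char (p m n : nat) (s s' : 'S_n) (chi : 'CF([set: 'S_n])) :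
  prime p -> (0 < m)%N -> comb_step p m (cycle_type s) (cycle_type s') ->
  chi \is a character -> (chi s == chi s' %[mod (p ^ m)%N])%C.
Proof.
move=> p_pr m_gt0 step chi_char.
suff : (chi s == chi s' %[mod (p ^ m)%N])%A.
  have chiQ u : chi u \in Crat.
    by have /intrP[z ->] := Cint_char_Sn u chi_char; apply: rpred_int.
  by rewrite eqAmod_rat ?rpred_nat.
have [N [b [t [N_gt0 pmN defn len_s len_s']]]] := comb_step_juxt p_pr m_gt0 step.
subst n.
have [w prim_w] := C_prim_root_exists N_gt0.
pose R := juxt (rotation N) (1%g : 'S_b); pose r := juxt (1%g : 'S_N) t.
have RX a : (R ^+ a * r)%g = juxt (rotation N ^+ a) t.
  by rewrite juxtX expg1n -juxtM mulg1 mul1g.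
have RN : (R ^+ N = 1)%g by rewrite juxtX expg1n rotationX_id ?juxt1.
have comRr : commute R r by rewrite /commute -!juxtM !mulg1 !mul1g.
have [f [fA _ fE]] := char_commuting_fourier chi_char (in_setT R) (in_setT r)
  comRr RN prim_w.
have chi_gcd a : chi (R ^+ a * r)%g = chi (R ^+ gcdn N a * r)%g.
  rewrite !RX; apply/char_cycle_lengths/eq_cycle_lengths => k.
  by rewrite !orbit_count_juxt !orbit_count_rotationX gcdnA gcdnn.
have [c cA cE] := gcd_fourier_coef (S := Aint) N_gt0 prim_w fA fE chi_gcd.
rewrite -(char_cycle_lengths chi len_s) -(char_cycle_lengths chi len_s').
rewrite -!RX !cE /eqAmod.
suff -> : \sum_(e <- divisors N | (e %| p ^ m)%N) e%:R * c e
    = (p ^ m)%:R * c (p ^ m)%N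
      + \sum_(e <- divisors N | (e %| p ^ m.-1)%N) e%:R * c e.
  have q_neq0 : (p ^ m)%:R != 0 :> algC by rewrite pnatr_eq0 -lt0n expn_gt0 prime_gt0.
  by rewrite addrK unfold_in ifN // mulrC mulKf.
rewrite -[LHS]big_filter (bigD1_seq (p ^ m)%N) ?filter_uniq ?divisors_uniq //=;
  last by rewrite mem_filter dvdnn -dvdn_divisors.
rewrite big_filter_cond; congr (_ + _); apply: eq_bigl => e.
apply/andP/idP => [[e_dv ne]|e_dv].
  have [k le_km def_e] := (dvdn_pfactor _ _ p_pr e_dv).
  rewrite def_e dvdn_exp2l // -ltnS prednK // ltn_neqAle le_km andbT.
  by apply: contraNneq ne => <-; rewrite def_e.
split; first by apply: dvdn_trans e_dv _; rewrite dvdn_exp2l ?leq_pred.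
apply: contraTneq e_dv => ->.
by rewrite dvdn_Pexp2l ?prime_gt1 // -ltnNge prednK.
Qed.

Lemma comb_equiv_char (p m n : nat) (s s' : 'S_n) :
  prime p -> (0 < m)%N -> comb_equiv p m (cycle_type s) (cycle_type s') ->
  forall chi : 'CF([set: 'S_n]), chi \is a character ->
    (chi s == chi s' %[mod (p ^ m)%N])%C.
Proof.
move=> p_pr m_gt0; move: s s'; apply: comb_equiv_sub.
- by move=> s s' eq_len chi _; rewrite (char_cycle_lengths chi eq_len) eqCmod_refl.
- by move=> s s' eq_chi chi chiP; rewrite eqCmod_sym eq_chi.
- by move=> s1 s2 s3 e12 e23 chi chiP; apply: eqCmod_trans (e12 _ chiP) (e23 _ chiP).
- by move=> s s' st chi; apply: comb_step_char.
Qed.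

End CharacterValues.

Theorem proposition4p2 (p m n : nat) (p_prime : prime p)
    (m_ge1 : 1 <= m) (n_ge1 : 1 <= n) (s s' : 'S_n) :
  (comb_equiv p m (cycle_type s) (cycle_type s') <-> group_equiv p m s s') /\
  (group_equiv p m s s' <->
     forall chi : 'CF([set: 'S_n]), chi \is a character ->
       (chi s == chi s' %[mod (p ^ m)%N])%C).
Proof.
have group_comb :
    group_equiv p m s s' -> comb_equiv p m (cycle_type s) (cycle_type s').
  move=> ss'; apply: comb_equiv_fixed_subsets => // j.
  exact: fixed_subsets_group_equiv.
split; split=> //.
- exact: comb_equiv_group_equiv.
- by move/group_comb; apply: comb_equiv_char.
- move=> eq_chi; apply: comb_equiv_group_equiv => //.
  by apply: comb_equiv_fixed_subsets => // j; apply: char_fixed_subsets.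
Qed.
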